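(* Let $C$ be a $d$-dimensional copula and let $\boldsymbol{t}=(t_1,\dots,t_d)\in(0,1]^d$ be such that $C(\boldsymbol{t})>0$. Then the copula $C_{\boldsymbol{t}}$ of $C$ right-truncated at $\boldsymbol{t}$ is given by $$C_{\boldsymbol{t}}(\boldsymbol{u})=\frac{C\bigl(C^{-1}[C(\boldsymbol{t})u_1;\boldsymbol{t}_{-1}],\dots,C^{-1}[C(\boldsymbol{t})u_d;\boldsymbol{t}_{-d}]\bigr)}{C(\boldsymbol{t})},\quad \boldsymbol{u}=(u_1,\dots,u_d)\in[0,1]^d.$$
   Context: A $d$-dimensional copula is a distribution function on $[0,1]^d$ with standard uniform univariate margins. For $\boldsymbol{U}\sim C$ and $\boldsymbol{t}\in(0,1]^d$ with $C(\boldsymbol{t})>0$, let $F_{\boldsymbol{t}}$ be the distribution function of the conditional distribution of $\boldsymbol{U}$ given $\boldsymbol{U}\le\boldsymbol{t}$ (componentwise inequality). The right-truncated copula $C_{\boldsymbol{t}}$ (the copula $C$ right-truncated at $\boldsymbol{t}$) is the (unique) copula of $F_{\boldsymbol{t}}$ in the sense of Sklar's Theorem. Notation: for $j\in\{1,\dots,d\}$, $\boldsymbol{t}_{-j}=(t_1,\dots,t_{j-1},t_{j+1},\dots,t_d)$ and $C(x_j;\boldsymbol{t}_{-j})=C(t_1,\dots,t_{j-1},x_j,t_{j+1},\dots,t_d)$ for $x_j\in[0,t_j]$. The map $y_j\mapsto C^{-1}[y_j;\boldsymbol{t}_{-j}]$ is the generalized inverse of the non-decreasing function $x_j\mapsto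 C(x_j;\boldsymbol{t}_{-j})$ on $[0,t_j]$, i.e. $C^{-1}[y_j;\boldsymbol{t}_{-j}]=\inf\{x_j\in[0,t_j]: C(x_j;\boldsymbol{t}_{-j})\ge y_j\}$ for $y_j\in[0,C(\boldsymbol{t})]$. *)

(* Defs.v *)
From HB Require Import structures.
From mathcomp Require Import all_boot all_order all_algebra.
From mathcomp Require Import all_classical all_reals all_analysis.

Set Implicit Arguments.
Unset Strict Implicit.
Unset Printing Implicit Defensive.

Import Order.TTheory GRing.Theory Num.Theory.
Import numFieldNormedType.Exports.

Local Open Scope classical_set_scope.
Local Open Scope ring_scope.

Definition in_unit_cube (R : realType) (d : nat) (u : 'I_d -> R) : Prop :=
  forall i, 0 <= u i <= 1.

(* (x_1, ..., x_{j-1}, s, x_{j+1}, ..., x_d) *)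
Definition set_coord (R : realType) (d : nat) (x : 'I_d -> R) (j : 'I_d) (s : R)
    : 'I_d -> R :=
  @dfwith 'I_d (fun=> R) x j s.

(* The event U <= x (componentwise). *)
Definition lower_orthant (T : Type) (R : realType) (d : nat)
    (U : 'I_d -> T -> R) (x : 'I_d -> R) : set T :=
  [set w | forall i, U i w <= x i].

Definition joint_cdf (disp : measure_display) (T : measurableType disp)
    (R : realType) (P : probability T R) (d : nat)
    (U : 'I_d -> {RV P >-> R}) (x : 'I_d -> R) : R :=
  fine (P (lower_orthant U x)).

Definition is_distribution_function (R : realType) (d : nat)
    (F : ('I_d -> R) -> R) : Prop :=
  exists (disp : measure_display) (T : measurableType disp)
         (P : probability T R) (U : 'I_d -> {RV P >-> R}),
    forall x, F x = joint_cdf U x.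

(* F_j(s) = F(+oo, ..., +oo, s, +oo, ..., +oo), with s in position j. *)
Definition margin (R : realType) (d : nat) (F : ('I_d -> R) -> R) (j : 'I_d)
    (s : R) : R :=
  lim (F (set_coord (fun=> M) j s) @[M --> +oo]).

(* A copula is only meaningful on the unit cube, so the values of the total
   function C outside of it are left unconstrained. *)
Definition is_copula (R : realType) (d : nat) (C : ('I_d -> R) -> R) : Prop :=
  exists F : ('I_d -> R) -> R,
    [/\ is_distribution_function F,
        forall (j : 'I_d) (s : R), 0 <= s <= 1 -> margin F j s = s
      & forall u, in_unit_cube u -> C u = F u].

(* U ~ C *)
Definition distributed_as (disp : measure_display) (T : measurableType disp)
    (R : realType) (P : probability T R) (d : nat)
    (U : 'I_d -> {RV P >-> R}) (C : ('I_d -> R) -> R) : Prop :=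
  forall u, in_unit_cube u -> joint_cdf U u = C u.

(* C is a copula of F in the sense of Sklar's theorem. *)
Definition is_copula_of (R : realType) (d : nat)
    (F : ('I_d -> R) -> R) (C : ('I_d -> R) -> R) : Prop :=
  is_copula C /\ forall x, F x = C (fun j => margin F j (x j)).

Definition cond_prob (disp : measure_display) (T : measurableType disp)
    (R : realType) (P : probability T R) (A B : set T) : R :=
  fine (P (A `&` B)) / fine (P B).

(* F_t: the distribution function of U conditionally on U <= t. *)
Definition truncated_cdf (disp : measure_display) (T : measurableType disp)
    (R : realType) (P : probability T R) (d : nat)
    (U : 'I_d -> {RV P >-> R}) (t : 'I_d -> R) (x : 'I_d -> R) : R :=
  cond_prob P (lower_orthant U x) (lower_orthant U t).

(* C^{-1}[y; t_{-j}] *)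
Definition copula_ginv (R : realType) (d : nat) (C : ('I_d -> R) -> R)
    (t : 'I_d -> R) (j : 'I_d) (y : R) : R :=
  inf [set x | 0 <= x <= t j /\ y <= C (set_coord t j x)].

(* Main.v *)
Require Import Defs.
From HB Require Import structures.
From mathcomp Require Import all_boot all_order all_algebra.
From mathcomp Require Import all_classical all_reals all_analysis.
From mathcomp Require Import lra.

Set Implicit Arguments.
Unset Strict Implicit.
Unset Printing Implicit Defensive.

Import Order.TTheory GRing.Theory Num.Theory.
Import numFieldNormedType.Exports.

Local Open Scope classical_set_scope.
Local Open Scope ring_scope.

(** Conditioning on [U <= t] is a change of probability: under [Q], the
    probability [P] given [U <= t], the truncated distribution function [F_t]
    is the joint distribution function of [U] itself. By Sklar's theorem, a
    copula of [F_t] is exactly a [D] with [F_t x = D (G x)], where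
    [G_j s = Q (U_j <= s)]. This equation forces [D] to be a copula: the margins
    [G_j] take every value of the unit interval, so the vector of the
    [G_j (U_j)] has uniform margins, and [D] is its joint distribution function
    on the cube ([is_copula_of_joint_cdf]).

    On [[0, t_j]] the margin is [G_j s = C(s; t_-j) / C t]. Since [C] is
    Lipschitz in each coordinate, [s |-> C(s; t_-j)] has no jump, and its
    generalized inverse is a genuine right inverse ([copula_ginvK]). So the
    point [x] with [x_j = C^-1[C t * u_j; t_-j]] satisfies [G x = u] and
    [0 <= x <= t], and for it the equation [F_t x = D (G x)] reads
    [C x / C t = D u], which is the formula. Conversely the formula gives the
    equation at every point, because [F_t] takes equal values at two points
    with the same image under [G] ([eq_joint_cdf]).

    Lipschitz continuity, the computation of margins and the last remark all
    come from one estimate ([fine_probability_forall_dist]): replacing each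
    event of a finite family by a comparable one changes the probability of the
    intersection by at most the sum of the individual changes. *)

(** * Intersections of finitely many events *)

Section real_probabilities.
Context (disp : measure_display) (T : measurableType disp) (R : realType).
Variable P : probability T R.

Lemma fine_probability_le (A B : set T) :
  measurable A -> measurable B -> A `<=` B -> fine (P A) <= fine (P B).
Proof.
by move=> mA mB AB; rewrite fine_le ?fin_num_measure ?le_measure ?inE.
Qed.

Lemma fine_probability_le1 (A : set T) : measurable A -> fine (P A) <= 1.
Proof.
by move=> mA; rewrite -lee_fin fineK ?fin_num_measure ?probability_le1.
Qed.

Lemma measurable_forall_ord (d : nat) (A : 'I_d -> set T) :
  (forall k, measurable (A k)) -> measurable [set w | forall k, A k w].
Proof.
move=> mA.
rewrite [X in measurable X](_ : _ = \bigcap_(k in [set: 'I_d]) A k).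
  by apply: fin_bigcap_measurable => //; exact: finite_finset.
by apply/seteqP; split=> [w wA k _|w wA k]; apply: wA.
Qed.

(** A point that lies in every [A k] but not in every [B k] lies in some
    [A k `\` B k]; the rest is subadditivity. *)
Lemma fine_probability_forall_le (d : nat) (A B : 'I_d -> set T) :
  (forall k, measurable (A k)) -> (forall k, measurable (B k)) ->
  fine (P [set w | forall k, A k w]) <=
  fine (P [set w | forall k, B k w]) + \sum_k fine (P (A k `\` B k)).
Proof.
move=> mA mB.
have mAB k : measurable (A k `\` B k) by exact: measurableD.
have [mU leU] : measurable (\big[setU/set0]_k (A k `\` B k)) /\
    fine (P (\big[setU/set0]_k (A k `\` B k))) <= \sum_k fine (P (A k `\` B k)).
  elim/big_ind2 : _ => [|X r Y s [mX Xr] [mY Ys]|k _].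
  - by rewrite measure0.
  - split; first exact: measurableU.
    rewrite (le_trans _ (lerD Xr Ys))// -fineD ?fin_num_measure// fine_le//.
    + by rewrite fin_num_measure//; exact: measurableU.
    + by rewrite fin_numD !fin_num_measure.
    + exact: measureU2.
  - by [].
have mB' := measurable_forall_ord mB.
rewrite (le_trans _ (lerD (lexx _) leU))// -fineD ?fin_num_measure//.
apply: fine_le.
- by rewrite fin_num_measure//; exact: measurable_forall_ord.
- by rewrite fin_numD !fin_num_measure.
apply: (le_trans _ (measureU2 _ mB' mU)).
rewrite le_measure ?inE//; [exact: measurable_forall_ord|exact: measurableU|].
move=> w /= wA; have [wB|] := pselect (forall k, B k w); first by left.
move=> /existsNP[k wBk]; right.
by rewrite (bigD1 k)//=; left.
Qed.

(** When [A k] and [B k] are comparable, one of the two differences is empty and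
    the other has probability [`|P (A k) - P (B k)|], so the previous estimate
    applies in both directions. Without comparability, [A k] and [B k]
    of equal probability may meet the other events differently. *)
Lemma fine_probability_forall_dist (d : nat) (A B : 'I_d -> set T) :
  (forall k, measurable (A k)) -> (forall k, measurable (B k)) ->
  (forall k, A k `<=` B k \/ B k `<=` A k) ->
  `|fine (P [set w | forall k, A k w]) - fine (P [set w | forall k, B k w])| <=
  \sum_k `|fine (P (A k)) - fine (P (B k))|.
Proof.
have diff X Y : measurable X -> measurable Y -> X `<=` Y \/ Y `<=` X ->
    fine (P (X `\` Y)) <= `|fine (P X) - fine (P Y)|.
  move=> mX mY [XY|YX].
    by move: XY; rewrite -setD_eq0 => ->; rewrite measure0 /=.
  rewrite measureD//; last by rewrite ltey_eq fin_num_measure.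
  by rewrite setIC (setIidl YX) fineB ?fin_num_measure// ler_norm.
move=> mA mB AB; rewrite ler_distlC.
apply/andP; split.
- rewrite lerBlDr (le_trans (fine_probability_forall_le mA mB))// lerD2l.
  by apply: ler_sum => k _; exact: diff.
- rewrite (le_trans (fine_probability_forall_le mB mA))// lerD2l.
  apply: ler_sum => k _; rewrite distrC; apply: diff => //.
  by have [] := AB k; [right|left].
Qed.

Lemma eq_fine_probability_forall (d : nat) (A B : 'I_d -> set T) :
  (forall k, measurable (A k)) -> (forall k, measurable (B k)) ->
  (forall k, A k `<=` B k \/ B k `<=` A k) ->
  (forall k, fine (P (A k)) = fine (P (B k))) ->
  fine (P [set w | forall k, A k w]) = fine (P [set w | forall k, B k w]).
Proof.
move=> mA mB AB eAB; apply/eqP; rewrite -subr_eq0 -normr_le0.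
rewrite (le_trans (fine_probability_forall_dist mA mB AB))//.
by rewrite big1// => k _; rewrite eAB subrr normr0.
Qed.

End real_probabilities.

(** * Distribution functions on the line *)

Section real_cdf.
Context (disp : measure_display) (T : measurableType disp) (R : realType).
Variable P : probability T R.
Implicit Types X : {RV P >-> R}.

Definition rcdf X (r : R) : R := fine (P [set w | X w <= r]).

Lemma preimage_le X r : [set w | X w <= r] = X @^-1` `]-oo, r].
Proof. by apply/seteqP; split=> w /=; rewrite in_itv. Qed.

Lemma measurable_le X r : measurable [set w | X w <= r].
Proof. by rewrite preimage_le; exact: measurable_sfunP. Qed.

Lemma rcdf_ge0 X r : 0 <= rcdf X r.
Proof. exact: fine_ge0. Qed.

Lemma rcdf_le1 X r : rcdf X r <= 1.
Proof. exact/fine_probability_le1/measurable_le. Qed.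

Lemma rcdf_nondecreasing X : {homo rcdf X : r s / r <= s}.
Proof.
move=> r s rs; apply: fine_probability_le; try exact: measurable_le.
by move=> w /= /le_trans; exact.
Qed.

Lemma cvg_rcdfy1 X : rcdf X r @[r --> +oo] --> (1 : R).
Proof.
rewrite (_ : rcdf X = fine \o cdf X).
  exact: fine_cvg (@cvg_cdfy1 _ _ _ _ X).
by apply/funext => r; rewrite /rcdf preimage_le.
Qed.

HB.instance Definition _ X := isMeasurableFun.Build _ _ _ _ (rcdf X)
  (measurable_realfun.nondecreasing_measurable measurableT
    (@rcdf_nondecreasing X)).

Definition integral_transform X : {RV P >-> R} := rcdf X \o X.

(** The probability integral transform. Having every value of the unit interval
    as a value of [rcdf X] replaces continuity. It yields [rcdf X x = u], and
    [X <= x] forces [rcdf X (X w) <= u], whence one inequality. For the other,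
    choose [y] with [rcdf X y = u + e]: then [rcdf X (X w) <= u] forces
    [X w <= y], an event of probability [u + e]; if
    [u + e > 1] there is nothing to prove. *)
Lemma rcdf_integral_transform X u :
  (forall v, 0 <= v <= 1 -> exists x, rcdf X x = v) ->
  0 <= u <= 1 -> rcdf (integral_transform X) u = u.
Proof.
move=> surj /[dup] u01 /andP[u0 u1]; apply/le_anti/andP; split.
- apply/ler_addgt0Pr => e e0.
  have [ue1|ue1] := leP (u + e) 1;
    last exact: le_trans (rcdf_le1 _ _) (ltW ue1).
  have [|y yue] := surj (u + e); first by lra.
  rewrite -yue; apply: fine_probability_le; try exact: measurable_le.
  move=> w /= Xu; rewrite leNgt; apply/negP => /ltW/(@rcdf_nondecreasing X).
  by rewrite yue; lra.
- have [x xu] := surj _ u01; rewrite -{1}xu.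
  apply: fine_probability_le; try exact: measurable_le.
  by move=> w /= /(@rcdf_nondecreasing X); rewrite xu.
Qed.

End real_cdf.

(** * Joint distribution functions, their margins, and Sklar's theorem *)

Section joint.
Context (disp : measure_display) (T : measurableType disp) (R : realType).
Variables (P : probability T R) (d : nat).
Implicit Types X : 'I_d -> {RV P >-> R}.

Lemma set_coord_same (x : 'I_d -> R) j s : set_coord x j s j = s.
Proof. exact: dfwithin. Qed.

Lemma set_coord_neq (x : 'I_d -> R) j s k : k != j -> set_coord x j s k = x k.
Proof. by move=> kj; apply: dfwithout; rewrite eq_sym. Qed.

Lemma measurable_lower_orthant X x : measurable (lower_orthant X x).
Proof.
exact: (measurable_forall_ord (fun k => measurable_le (X k) (x k))).
Qed.

Lemma joint_cdf_lipschitz X x y :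
  `|joint_cdf X x - joint_cdf X y| <=
  \sum_k `|rcdf (X k) (x k) - rcdf (X k) (y k)|.
Proof.
apply: (fine_probability_forall_dist P (A := fun k => [set w | X k w <= x k])
  (B := fun k => [set w | X k w <= y k])) => k; try exact: measurable_le.
have [xy|/ltW yx] := leP (x k) (y k); [left|right] => w /= /le_trans; exact.
Qed.

Lemma eq_joint_cdf X x y :
  (forall k, rcdf (X k) (x k) = rcdf (X k) (y k)) ->
  joint_cdf X x = joint_cdf X y.
Proof.
move=> xy; apply/eqP; rewrite -subr_eq0 -normr_le0.
rewrite (le_trans (joint_cdf_lipschitz _ _ _))//.
by rewrite big1// => k _; rewrite xy subrr normr0.
Qed.

Lemma joint_cdf_le_rcdf X x j : joint_cdf X x <= rcdf (X j) (x j).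
Proof.
apply: fine_probability_le; first exact: measurable_lower_orthant.
  exact: measurable_le.
by move=> w; exact.
Qed.

(** Sending the other coordinates to infinity replaces their events by the whole
    space, each at the cost [1 - rcdf (X k) (b k)]. *)
Lemma joint_cdf_margin_dist X b j s :
  `|rcdf (X j) s - joint_cdf X (set_coord b j s)| <=
  \sum_(k | k != j) (1 - rcdf (X k) (b k)).
Proof.
pose B k := if k == j then [set w | X j w <= s] else setT.
have -> : rcdf (X j) s = fine (P [set w | forall k, B k w]).
  congr (fine (P _)); apply/seteqP; split=> [w Xs k|w /(_ j)].
    by rewrite /B; case: eqP.
  by rewrite /B eqxx.
have mB k : measurable (B k).
  by rewrite /B; case: eqP => // _; exact: measurable_le.
apply: le_trans.
  apply: (fine_probability_forall_dist P mB
    (B := fun k => [set w | X k w <= set_coord b j s k])) => k.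
    exact: measurable_le.
  rewrite /B; case: eqP => [->|_]; last by right.
  by left; rewrite set_coord_same.
rewrite (bigD1 j)//= {1}/B eqxx set_coord_same subrr normr0 add0r.
apply: ler_sum => k kj; rewrite /B (negbTE kj) probability_setT.
rewrite set_coord_neq//=.
by rewrite ger0_norm// subr_ge0; exact: rcdf_le1.
Qed.

Lemma joint_cdf_margin X b j s :
  (forall k, k != j -> rcdf (X k) (b k) = 1) ->
  joint_cdf X (set_coord b j s) = rcdf (X j) s.
Proof.
move=> b1; apply/esym/eqP; rewrite -subr_eq0 -normr_le0.
rewrite (le_trans (joint_cdf_margin_dist _ _ _ _))//.
by rewrite big1// => k /b1 ->; rewrite subrr.
Qed.

Lemma margin_joint_cdf X j s : margin (joint_cdf X) j s = rcdf (X j) s.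
Proof.
apply: cvg_lim => //.
have cvg0 : \sum_(k | k != j) (1 - rcdf (X k) M) @[M --> +oo] -->
    \sum_(k < d | k != j) (1 - 1 : R).
  apply: cvg_big => [|k _]; first exact: add_continuous.
  by apply: cvgB; [exact: cvg_cst|exact: cvg_rcdfy1].
rewrite subrr big1// in cvg0.
apply/cvgrPdist_le => e e0.
move/cvgrPdist_le : cvg0 => /(_ e e0); apply: filterS => M.
rewrite sub0r normrN => Me.
apply: le_trans (joint_cdf_margin_dist _ _ _ _) (le_trans (ler_norm _) Me).
Qed.

(** If the margins take all values in the unit interval, every solution [D] of
    Sklar's equation is a copula: on the unit cube it is the joint distribution
    function of the integral transforms. Indeed if [u] is the vector of the
    [rcdf (X j) (x j)], then the events [X j <= x j] and
    [rcdf (X j) (X j) <= u j] are nested and both have probability [u j]. *)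
Lemma is_copula_of_joint_cdf X (D : ('I_d -> R) -> R) :
  (forall j v, 0 <= v <= 1 -> exists x, rcdf (X j) x = v) ->
  is_copula_of (joint_cdf X) D <->
  forall x, joint_cdf X x = D (fun j => rcdf (X j) (x j)).
Proof.
move=> surj.
have GE x : (fun j => margin (joint_cdf X) j (x j)) = fun j => rcdf (X j) (x j).
  by apply/funext => j; rewrite margin_joint_cdf.
split=> [[_ FD] x|FD]; first by rewrite FD GE.
split; last by move=> x; rewrite GE.
exists (joint_cdf (fun j => integral_transform (X j))); split.
- by exists disp, T, P, (fun j => integral_transform (X j)).
- move=> j s s01; rewrite margin_joint_cdf.
  by rewrite rcdf_integral_transform//; exact: surj.
- move=> u u01.
  have [x xu] := choice (fun j => surj j _ (u01 j)).
  rewrite -(_ : (fun j => rcdf (X j) (x j)) = u); last exact/funext.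
  rewrite -FD.
  apply: (eq_fine_probability_forall (A := fun k => [set w | X k w <= x k])
    (B := fun k => [set w |
      integral_transform (X k) w <= rcdf (X k) (x k)])) => k.
  + exact: measurable_le.
  + exact: measurable_le.
  + by left=> w /=; exact: rcdf_nondecreasing.
  + rewrite -/(rcdf _ _) -/(rcdf _ _) rcdf_integral_transform//;
      first exact: surj.
    by rewrite xu.
Qed.

End joint.

(** * Conditioning on an event *)

Section conditioning.
Context (disp : measure_display) (T : measurableType disp) (R : realType).
Variables (P : probability T R) (E : set T) (mE : measurable E).

(** When [E] has probability 0 this falls back on [P], so that it is a
    probability for every [E]. *)
Definition given : probability T R := mnormalize (mrestr P mE) P.

Lemma givenE A : measurable A -> 0 < fine (P E) ->
  fine (given A) = cond_prob P A E.
Proof.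
move=> mA PE0; rewrite /given /= /mnormalize /= /mrestr setTI.
have PEfin : P E \is a fin_num by exact: fin_num_measure.
case: ifPn => [/orP[/eqP PE|/eqP PE]|_].
- by rewrite PE ltxx in PE0.
- by rewrite PE in PEfin.
- by rewrite fineM// fin_num_measure//; exact: measurableI.
Qed.

End conditioning.

(** * The generalized inverse of a section of a copula *)

Section copula.
Context (R : realType) (d : nat) (C : ('I_d -> R) -> R).
Hypothesis C_copula : is_copula C.
Context (disp : measure_display) (T : measurableType disp).
Context (P : probability T R) (U : 'I_d -> {RV P >-> R}).
Hypothesis UC : distributed_as U C.

(** Being a copula gives uniform margins for some vector [X], possibly living on
    another space than [U]. On the faces of the cube through the vertex
    [(1, ..., 1)] this becomes a property of [C] alone, hence of [U]. *)
Lemma copula_margin j s : 0 <= s <= 1 -> C (set_coord (fun=> 1) j s) = s.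
Proof.
move=> s01; have [F [[disp' [T' [P' [X FX]]]] Fm CF]] := C_copula.
have {}FX : F = joint_cdf X by exact/funext.
have Xm k r : 0 <= r <= 1 -> rcdf (X k) r = r.
  by move=> r01; rewrite -margin_joint_cdf -FX Fm.
rewrite CF ?FX; last first.
  move=> k; have [->|kj] := eqVneq k j; first by rewrite set_coord_same.
  by rewrite set_coord_neq// ler01 lexx.
by rewrite joint_cdf_margin ?Xm// => k _; rewrite Xm// ler01 lexx.
Qed.

(** At [s = 1] the previous lemma says that all coordinates are at most 1 almost
    surely, so bounding the other coordinates by 1 imposes nothing. *)
Lemma rcdf_uniform j s : 0 <= s <= 1 -> rcdf (U j) s = s.
Proof.
have in01 r : 0 <= r <= 1 -> in_unit_cube (set_coord (fun=> 1) j r).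
  move=> r01 k; have [->|kj] := eqVneq k j; first by rewrite set_coord_same.
  by rewrite set_coord_neq// ler01 lexx.
have U1 k : k != j -> rcdf (U k) 1 = 1.
  move=> kj; apply/le_anti; rewrite rcdf_le1 /=.
  have r11 : 0 <= (1 : R) <= 1 by rewrite ler01 lexx.
  have := joint_cdf_le_rcdf U (set_coord (fun=> 1) j 1) k.
  by rewrite UC ?copula_margin ?set_coord_neq//; exact: in01.
move=> s01; rewrite -(@joint_cdf_margin _ _ _ _ _ U (fun=> 1))// UC.
  exact: copula_margin.
exact: in01.
Qed.

(** The section [h s = C(s; t_-j)] is 1-Lipschitz with [h 0 = 0] and
    [h (t j) = C t]. At the infimum [i] of [h s >= y], points of the set just
    above [i] give [h i >= y], and points outside of it just below [i] give
    [h i <= y] (if [i = 0] then [h i = 0 <= y]). *)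
Lemma copula_ginvK t j y : (forall i, 0 < t i <= 1) -> 0 <= y <= C t ->
  0 <= copula_ginv C t j y <= t j /\
  C (set_coord t j (copula_ginv C t j y)) = y.
Proof.
move=> t01 /andP[y0 yC]; pose h s := C (set_coord t j s).
have /andP[tj0 tj1] := t01 j.
have st01 s : 0 <= s <= t j -> in_unit_cube (set_coord t j s).
  move=> /andP[s0 st] k; have [->|kj] := eqVneq k j.
    by rewrite set_coord_same s0 (le_trans st).
  by rewrite set_coord_neq//; have /andP[/ltW -> ->] := t01 k.
have h0 : h 0 = 0.
  have z01 : 0 <= (0 : R) <= t j by rewrite lexx ltW.
  rewrite /h -UC; last exact: st01.
  apply/le_anti/andP; split; last exact: fine_ge0.
  rewrite (le_trans (joint_cdf_le_rcdf _ _ j))// set_coord_same rcdf_uniform//.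
  by rewrite lexx ler01.
have ht : h (t j) = C t.
  congr C; apply/funext => k; have [->|kj] := eqVneq k j.
    by rewrite set_coord_same.
  by rewrite set_coord_neq.
have h_lip r s : 0 <= r -> r <= s -> s <= t j -> h s <= h r + (s - r).
  move=> r0 rs st.
  rewrite /h -!UC; [|apply: st01; lra|apply: st01; lra].
  rewrite -lerBlDl (le_trans (ler_norm _))//.
  rewrite (le_trans (joint_cdf_lipschitz _ _ _))//.
  rewrite (bigD1 j)//= !set_coord_same !rcdf_uniform; [|lra|lra].
  rewrite big1 ?addr0 ?ger0_norm ?subr_ge0// => k kj.
  by rewrite !set_coord_neq// subrr normr0.
pose S := [set x | 0 <= x <= t j /\ y <= h x].
have St : S (t j) by split; [rewrite lexx ltW|rewrite ht].
have S0 : lbound S 0 by move=> x [/andP[]].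
have infS : has_inf S by split; [exists (t j)|exists 0].
have i0 : 0 <= inf S by apply: lb_le_inf => //; exists (t j).
have it : inf S <= t j by apply: ge_inf => //; exists 0.
rewrite /copula_ginv -/S; split; first exact/andP.
apply/le_anti/andP; split.
- have [->|i_gt0] := eqVneq (inf S) 0; first by rewrite -/(h 0) h0.
  apply/ler_addgt0Pr => e e0.
  (* the Lipschitz bound is used inside the cube only, hence the cut at 0 *)
  pose r := Num.max 0 (inf S - e).
  have r0 : 0 <= r by rewrite le_max lexx.
  have ri : r < inf S.
    by rewrite gt_max lt_neqAle eq_sym i_gt0 i0 /= ltrBlDr ltrDl.
  have hr : h r < y.
    rewrite ltNge; apply/negP => yr.
    have : inf S <= r.
      by apply: ge_inf; [exists 0|split=> //; rewrite r0 /=; lra].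
    by rewrite leNgt ri.
  have ire : inf S - e <= r by rewrite le_max lexx orbT.
  have := h_lip r (inf S) r0 (ltW ri) it; rewrite {1}/h; lra.
- apply/ler_addgt0Pr => e e0.
  have [x [/andP[x0 xt] yx] xi] := inf_adherent e0 infS.
  have ix : inf S <= x by apply: ge_inf; [exists 0|split=> //; exact/andP].
  have := h_lip _ _ i0 ix xt; rewrite {2}/h; lra.
Qed.

End copula.

Theorem proposition2p5 (R : realType) (d : nat) (C : ('I_d -> R) -> R)
    (C_copula : is_copula C)
    (t : 'I_d -> R) (t01 : forall i, 0 < t i <= 1) (Ct_gt0 : 0 < C t)
    (disp : measure_display) (T : measurableType disp) (P : probability T R)
    (U : 'I_d -> {RV P >-> R}) (UC : distributed_as U C)
    (D : ('I_d -> R) -> R) :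
  is_copula_of (truncated_cdf U t) D <->
  (forall u, in_unit_cube u ->
     D u = C (fun j => copula_ginv C t j (C t * u j)) / C t).
Proof.
have PtE : fine (P (lower_orthant U t)) = C t.
  by rewrite -UC// => i; have /andP[/ltW -> ->] := t01 i.
pose mt := measurable_lower_orthant U t.
pose Q := given P mt.
pose V : 'I_d -> {RV Q >-> R} := U.
have QE A : measurable A -> fine (Q A) = cond_prob P A (lower_orthant U t).
  by move=> mA; rewrite givenE// PtE.
have -> : truncated_cdf U t = joint_cdf V
  by apply/funext => x; rewrite /truncated_cdf -QE//;
    exact: measurable_lower_orthant.
have VE x : (forall j, 0 <= x j <= t j) -> joint_cdf V x = C x / C t.
  move=> x0t; rewrite /joint_cdf QE; last exact: measurable_lower_orthant.
  rewrite /cond_prob PtE; congr (_ / _).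
  rewrite -UC => [|j]; last first.
    have /andP[-> xt] := x0t j; have /andP[_ t1] := t01 j.
    exact: le_trans xt t1.
  congr (fine (P _)); apply/setIidl => w wx j.
  by have /andP[_] := x0t j; apply: le_trans.
(* under [Q] the other coordinates are already bounded by [t], so the event
   [U_j <= s] is the orthant with corner [set_coord t j s] *)
have GE j s : 0 <= s <= t j -> rcdf (V j) s = C (set_coord t j s) / C t.
  move=> s0t; rewrite -VE => [|k]; last first.
    have [->|kj] := eqVneq k j; first by rewrite set_coord_same.
    by rewrite set_coord_neq// lexx andbT; have /andP[/ltW] := t01 k.
  rewrite /rcdf /joint_cdf !QE; [|exact: measurable_lower_orthant
    |exact: measurable_le].
  rewrite /cond_prob; congr (fine (P _) / _).
  apply/seteqP; split=> w [ws wt]; split=> //.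
    move=> k; have [->|kj] := eqVneq k j; first by rewrite set_coord_same.
    by rewrite set_coord_neq.
  by have := ws j; rewrite set_coord_same.
pose q (u : 'I_d -> R) j := copula_ginv C t j (C t * u j).
have qP u j : 0 <= u j <= 1 -> 0 <= q u j <= t j /\ rcdf (V j) (q u j) = u j.
  move=> /andP[u0 u1].
  have [|q0t Cq] := @copula_ginvK _ _ _ C_copula _ _ _ _ UC t j (C t * u j) t01.
    by rewrite mulr_ge0 ?(ltW Ct_gt0)//= ler_piMr// ltW.
  by split=> //; rewrite GE// Cq mulrAC divff ?mul1r ?gt_eqF.
have Gq u : in_unit_cube u -> (fun j => rcdf (V j) (q u j)) = u.
  by move=> u01; apply/funext => j; apply: (qP _ _ (u01 j)).2.
have Vq u : in_unit_cube u -> joint_cdf V (q u) = C (q u) / C t.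
  by move=> u01; apply: VE => j; apply: (qP _ _ (u01 j)).1.
rewrite is_copula_of_joint_cdf; last first.
  by move=> j v v01; exists (q (fun=> v) j); apply: (qP (fun=> v) j v01).2.
split=> [VD u u01|DE x].
- by rewrite -/(q u) -Vq// VD Gq.
- have x01 : in_unit_cube (fun j => rcdf (V j) (x j)).
    by move=> j; rewrite rcdf_ge0 rcdf_le1.
  rewrite DE// -/(q _) -Vq//; apply: eq_joint_cdf => k.
  by have [_ ->] := qP _ k (x01 k).
Qed.
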